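(* Let $F$ be a finitely generated free group of rank at least $2$. Then the space of left-invariant orderings on $F$ has no isolated points.
   Context: A left-invariant ordering on a group $F$ is a total (linear) order $<$ on $F$ such that $a < b$ implies $ca < cb$ for all $a,b,c \in F$. Left-invariant orderings of $F$ are in one-to-one correspondence with positive cones, i.e. subsets $P \subset F$ closed under multiplication such that $F$ is the disjoint union $F = \{1\} \sqcup P \sqcup P^{-1}$, where $P^{-1} = \{p^{-1} \mid p \in P\}$; the ordering $<$ corresponds to $P = \{g \in F \mid 1 < g\}$. The space of left-invariant orderings is the set of all positive cones with the Chabauty topology, that is, the subspace topology inherited from the power set $\{0,1\}^F$ with the product topology. Thus an ordering with positive cone $P$ is isolated if and only if there is a finite set $S \subset F$ such that every positive cone $P'$ of a left-invariant ordering of $F$ with $P \cap S = P' \cap S$ satisfies $P' = P$. *)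

(* Defs.v *)
From HB Require Import structures.
From mathcomp Require Import all_boot.
From mathcomp Require Import boolp classical_sets functions topology.

Set Implicit Arguments.
Unset Strict Implicit.
Unset Printing Implicit Defensive.

Local Open Scope classical_set_scope.
Local Open Scope group_scope.

(* Universal property of a free basis. [groupType] bundles a choice operator,
   which every group has classically, so [G] ranges over all groups. *)
Definition free_basis (I : Type) (F : groupType) (x : I -> F) : Prop :=
  forall (G : groupType) (y : I -> G),
    exists f : F -> G,
      [/\ {morph f : a b / a * b},
          forall i, f (x i) = y i &
          forall f' : F -> G, {morph f' : a b / a * b} ->
            (forall i, f' (x i) = y i) -> f' =1 f].

Definition free_of_rank (n : nat) (F : groupType) : Prop :=
  exists x : 'I_n -> F, free_basis x.

Definition left_ordering (F : groupType) (lt : rel F) : Prop :=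
  [/\ irreflexive lt, transitive lt,
      forall a b, a != b -> lt a b || lt b a &
      forall a b c, lt a b -> lt (c * a) (c * b)].

(* Subsets of [F] are points of the product [{0,1}^F]. *)
Definition positive_cone (F : groupType) : set {ptws F -> bool} :=
  [set P : F -> bool |
    let C := [set g | P g] in
    let C' := [set p^-1 | p in C] in
    [/\ forall g h, C g -> C h -> C (g * h),
        [set: F] = [set 1] `|` C `|` C' &
        [/\ [set 1] `&` C = set0, [set 1] `&` C' = set0 & C `&` C' = set0]]].

(* [set_type] carries the subspace topology. *)
Definition left_ordering_space (F : groupType) : topologicalType :=
  set_type (positive_cone (F := F)).

Lemma left_ordering_positive_cone (F : groupType) (lt : rel F) :
  left_ordering lt -> positive_cone (lt 1).
Proof.
move=> [irr tr tot linv].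
have invE p : lt 1 p -> lt p^-1 1.
  by move=> /(linv _ _ p^-1); rewrite mulg1 mulVg.
split=> /=.
- by move=> g h g0 /(linv _ _ g); rewrite mulg1; apply: tr.
- apply/seteqP; split=> // g _; have [->|g1] := eqVneq g 1; first by left; left.
  have /orP[g0|g0] := tot _ _ g1; last by left; right.
  right; exists g^-1; last by rewrite invgK.
  by move: g0 => /(linv _ _ g^-1); rewrite mulg1 mulVg.
- split; apply/seteqP; split=> // g /=.
  + by move=> [-> ]; rewrite irr.
  + by move=> [->] [p p0 /(congr1 (fun z => z^-1))]; rewrite invgK invg1 => p1;
    rewrite p1 irr in p0.
  + by move=> [g0] [p /invE p0 pg]; rewrite pg in p0; have := tr _ _ _ g0 p0; rewrite irr.
Qed.

Lemma positive_cone_left_ordering (F : groupType) (P : F -> bool) :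
  positive_cone P ->
  exists! lt : rel F, left_ordering lt /\ P = lt 1.
Proof.
move=> [/= mulP covP [P1 _ PV]].
have nP1 : P 1 = false.
  by apply/negP => p1; have : (set0 : set F) 1 by rewrite -P1.
exists (fun a b => P (a^-1 * b)); split.
- split; last by apply/funext => g; rewrite invg1 mul1g.
  split.
  + by move=> a; rewrite mulVg nP1.
  + by move=> b a c ab bc; have := mulP _ _ ab bc; rewrite -mulgA mulVKg.
  + move=> a b ab; have : [set: F] (a^-1 * b) by [].
    rewrite covP => -[[/= e|/= ->//]|[p /= Pp e]].
      by move: ab; rewrite -(mulVKg a b) e mulg1 eqxx.
    by rewrite -[b^-1 * a]invgK invgM invgK -e invgK Pp orbT.
  + by move=> a b c; rewrite invgM -mulgA mulKg.
- move=> lt [[_ _ _ linv] ->]; apply/funext => a; apply/funext => b.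
  apply/idP/idP => [/(linv _ _ a)|/(linv _ _ a^-1)].
    by rewrite mulg1 mulVKg.
  by rewrite mulVg.
Qed.

(* Main.v *)
Require Import Defs.
From HB Require Import structures.
From mathcomp Require Import all_boot all_order all_algebra.
From mathcomp Require Import boolp classical_sets functions topology.
From mathcomp Require Import lra.

(** Given a positive cone [P] of the free group [F] and a finite set [S], a
    second positive cone [P'] is built that agrees with [P] on [S].  The order
    of [P] is seen through the left translation action of [F] on the ordered
    set [F].  Only a finite part of this action matters for [S]: a finite set
    [T] containing [1] and [S] whose points are joined to [1] inside [T] by
    edges [u -- x i * u] of the Cayley graph ([joined_cover]).  Place [T] in
    the rational line in the order of [P] ([position]).  Each basis element then
    acts as a finite increasing partial map, and any such map extends to an
    increasing bijection of the line ([increasing_extension]).  As [F] is free,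
    arbitrary extensions, one for each basis element, define an action of [F]
    ([free_basis_increasing_action]).  Comparing [phi g p] with [p], where [p]
    is the point of [1], and deciding ties by [P], gives a positive cone
    ([orbit_cone_positive]); it agrees with [P] on [T] because [phi u p] is the
    point of [u] for every [u] in [T].

    That the rank is at least 2 serves to make [P'] differ from [P]
    ([cone_perturbation]).  Let [t] be the greatest point of [T].  One of
    [x i * t] and [(x i)^-1 * t] lies above [t]; call it [t'] and place it
    beyond [T].  For another basis element [x j], only the edges inside [T] are
    prescribed, so the image of the point of [t'] under [x j] may be chosen on
    either side of that point.  This choice decides the sign of
    [t'^-1 * x j * t'], and is made against [P].

    Finally, neighborhoods for pointwise convergence only constrain finitely
    many values ([nbhs_ptws_bool]), so no positive cone is isolated. *)

Set Implicit Arguments.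
Unset Strict Implicit.
Unset Printing Implicit Defensive.

Import Order.TTheory GRing.Theory Num.Theory.

Local Open Scope group_scope.

(** * Multiplicative maps between groups *)

Section RawMorphism.
Variables (F G : groupType) (f : F -> G).
Hypothesis fM : {morph f : a b / a * b}.

Lemma morph_one : f 1 = 1.
Proof. by apply: (mulgI (f 1)); rewrite -fM !mulg1. Qed.

Lemma morph_inv a : f a^-1 = (f a)^-1.
Proof. by apply: (mulgI (f a)); rewrite -fM !mulgV morph_one. Qed.

End RawMorphism.

(** * The group of bijections of a type *)

Record bijection (T : Type) := Bijection {
  bij_fun :> T -> T;
  bij_inv : T -> T;
  bij_funK : cancel bij_fun bij_inv;
  bij_invK : cancel bij_inv bij_fun }.

Section BijectionGroup.
Variable T : Type.
Implicit Types s t : bijection T.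

Lemma bij_ext s t : s =1 t -> s = t.
Proof.
case: s t => [f g fK gK] [f' g' fK' gK'] /= /funext ff'.
case: f' / ff' in fK' gK' *; suff gg' : g = g'.
  by case: g' / gg' in fK' gK' *; congr Bijection; apply: Prop_irrelevance.
by apply/funext => a; rewrite -[LHS]fK' gK.
Qed.

Definition bij_one := @Bijection T id id (fun=> erefl) (fun=> erefl).
Definition bij_opp s := Bijection (@bij_invK T s) (@bij_funK T s).
Definition bij_mul s t :=
  Bijection (can_comp (@bij_funK T s) (@bij_funK T t))
            (can_comp (@bij_invK T t) (@bij_invK T s)).

HB.instance Definition _ := gen_eqMixin (bijection T).
HB.instance Definition _ := gen_choiceMixin (bijection T).

Fact bij_mulA : associative bij_mul. Proof. by move=> *; exact: bij_ext. Qed.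
Fact bij_1mul : left_id bij_one bij_mul. Proof. by move=> *; exact: bij_ext. Qed.
Fact bij_mul1 : right_id bij_one bij_mul. Proof. by move=> *; exact: bij_ext. Qed.
Fact bij_Vmul : left_inverse bij_one bij_opp bij_mul.
Proof. by move=> s; apply: bij_ext => a /=; rewrite bij_funK. Qed.
Fact bij_mulV : right_inverse bij_one bij_opp bij_mul.
Proof. by move=> s; apply: bij_ext => a /=; rewrite bij_invK. Qed.

HB.instance Definition _ := isGroup.Build (bijection T)
  bij_mulA bij_1mul bij_mul1 bij_Vmul bij_mulV.

Lemma bijM s t a : (s * t) a = s (t a). Proof. by []. Qed.
Lemma bij1 a : (1 : bijection T) a = a. Proof. by []. Qed.
Lemma bijK s a : s^-1 (s a) = a. Proof. exact: bij_funK. Qed.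
Lemma bijVK s a : s (s^-1 a) = a. Proof. exact: bij_invK. Qed.
Lemma bij_injective s : injective s. Proof. exact: can_inj (@bij_funK T s). Qed.

End BijectionGroup.

(** * Generation of a free group by its basis *)

(** The universal property yields generation without the subgroup spanned by
    the basis.  Let [F] act on [F * bool] by translating the first component,
    and conjugate this action by the involution [flip] that toggles the second
    component over [Q].  The two actions agree at [h] exactly when translation
    by [h] preserves [Q]; they agree on the basis, hence everywhere. *)
Lemma free_basis_invariant (I : Type) (F : groupType) (x : I -> F)
    (Q : F -> Prop) : free_basis x ->
  (forall i g, Q (x i * g) <-> Q g) -> forall h g, Q (h * g) <-> Q g.
Proof.
move=> hx Qx.
pose q g := `[< Q g >].
have qx i g : q (x i * g) = q g.
  exact/asbool_equiv_eq/Qx.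
have lmulK h : cancel (fun z : F * bool => (h * z.1, z.2))
                      (fun z => (h^-1 * z.1, z.2)).
  by case=> g b /=; rewrite mulKg.
have lmulVK h : cancel (fun z : F * bool => (h^-1 * z.1, z.2))
                       (fun z => (h * z.1, z.2)).
  by case=> g b /=; rewrite mulVKg.
pose lmul h := Bijection (lmulK h) (lmulVK h).
pose flip z := (z.1, z.2 (+) q z.1) : F * bool.
have flipK : involutive flip by case=> g b; rewrite /flip /= addbK.
pose tau : bijection (F * bool) := Bijection flipK flipK.
have lmulM : {morph lmul : a b / a * b}.
  by move=> a b; apply: bij_ext => -[g e] /=; rewrite mulgA.
pose twisted h := tau^-1 * lmul h * tau.
have twistedM : {morph twisted : a b / a * b}.
  by move=> a b; rewrite /twisted lmulM !mulgA mulgK.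
have [f [_ _ funiq]] := hx _ (fun i => lmul (x i)).
have twistedE : twisted =1 lmul.
  move=> h; rewrite [RHS]funiq //; apply: funiq => // i.
  by apply: bij_ext => -[g b]; rewrite /= /flip /= qx addbK.
move=> h g; have /(congr1 (fun s : bijection _ => (s (g, q g)).2)) := twistedE h.
by rewrite /= addbb /=; apply: asbool_eq_equiv.
Qed.

Lemma free_basis_ind (I : Type) (F : groupType) (x : I -> F) (Q : F -> Prop) :
  free_basis x -> Q 1 -> (forall i g, Q (x i * g) <-> Q g) -> forall g, Q g.
Proof.
by move=> hx Q1 Qx g; rewrite -[g]mulg1; exact/(free_basis_invariant hx Qx).
Qed.

(** * Increasing bijections of the rational line *)

Section IncreasingBijections.
Local Open Scope ring_scope.

Definition increasing (f : rat -> rat) := {homo f : a b / a < b}.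

Lemma increasing_mono (f : rat -> rat) : increasing f -> {mono f : a b / a < b}.
Proof. by move=> /le_mono/leW_mono. Qed.

(** Induction step of [increasing_extension]: the part of an increasing
    bijection below [a] may be replaced by any affine map of positive slope
    that takes the same value at [a]. *)
Lemma increasing_glue (a b m : rat) (f : bijection rat) :
  0 < m -> increasing f -> f a = b ->
  exists h : bijection rat, [/\ increasing h,
    forall u, a <= u -> h u = f u &
    forall u, u < a -> h u = b + m * (u - a)].
Proof.
move=> m0 fi fab; have fm := increasing_mono fi.
pose h u := if a <= u then f u else b + m * (u - a).
pose k v := if b <= v then (f^-1)%g v else a + m^-1 * (v - b).
have fge u : (b <= f u) = (a <= u) by rewrite -fab !leNgt fm.
have hK : cancel h k.
  move=> u; rewrite /h /k; case: (leP a u) => [au|ua].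
    by rewrite fge au bijK.
  rewrite leNgt gtrDl pmulr_rlt0 // subr_lt0 ua /=.
  by rewrite [b + _]addrC addrK mulKf ?gt_eqF// addrC subrK.
have kK : cancel k h.
  move=> v; rewrite /h /k; case: (leP b v) => [bv|vb].
    by rewrite -fge bijVK bv.
  rewrite leNgt gtrDl pmulr_rlt0 ?invr_gt0// subr_lt0 vb /=.
  by rewrite [a + _]addrC addrK mulVKf ?gt_eqF// addrC subrK.
exists (Bijection hK kK); split=> [u v uv|u au|u ua] /=.
- rewrite /h; case: (leP a u) => [au|ua].
    by rewrite (le_trans au (ltW uv)); exact: fi.
  case: (leP a v) => [av|va]; last by rewrite ltrD2l ltr_pM2l// ltrD2r.
  apply: (@lt_le_trans _ _ b); last by rewrite fge.
  by rewrite gtrDl pmulr_rlt0 // subr_lt0.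
- by rewrite /h au.
- by rewrite /h leNgt ua.
Qed.

Definition increasing_graph (s : seq (rat * rat)) :=
  {in s &, forall p q, (p.1 < q.1) = (p.2 < q.2)}.

(** With the pairs sorted, the extension is built from the top down: it is
    affine between consecutive points, and a translation beyond both ends. *)
Lemma increasing_extension (s : seq (rat * rat)) : increasing_graph s ->
  exists2 f : bijection rat, increasing f & {in s, forall p, f p.1 = p.2}.
Proof.
pose le1 (p q : rat * rat) := p.1 <= q.1.
have le1_total : total le1 by move=> p q; exact: le_total.
move=> cons_s; pose t := sort le1 (undup s).
have ts : t =i s by move=> p; rewrite mem_sort mem_undup.
have : uniq t by rewrite sort_uniq undup_uniq.
have : sorted le1 t by exact: sort_sorted.
have : increasing_graph t by move=> p q; rewrite !ts; exact: cons_s.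
suff ext : forall t, increasing_graph t -> sorted le1 t -> uniq t ->
    exists2 f : bijection rat, increasing f & {in t, forall p, f p.1 = p.2}.
  by move=> ? ? /ext[]// f fi ft; exists f => // p ps; apply: ft; rewrite ts.
move=> {s t cons_s ts}; elim=> [|[a b] t IH] cons_t; first by exists 1%g.
case: t => [|[c d] t] in IH cons_t * => [_ _|].
  have cK : cancel (+%R^~ (b - a)) (+%R^~ (- (b - a))) by move=> u; rewrite addrK.
  have Kc : cancel (+%R^~ (- (b - a))) (+%R^~ (b - a)) by move=> u; rewrite subrK.
  exists (Bijection cK Kc) => [u v|p]; first by rewrite /= ltrD2r.
  by rewrite inE => /eqP -> /=; rewrite addrC subrK.
move=> /andP[/= ac ct] /andP[/= abN ut].
have [|//|//|f fi ft] := IH.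
  by move=> p q ps qs; apply: cons_t; rewrite inE ?ps ?qs orbT.
have abt : (a, b) \in (a, b) :: (c, d) :: t by rewrite mem_head.
have cdt : (c, d) \in (a, b) :: (c, d) :: t by rewrite !inE eqxx orbT.
have lt_ac : a < c.
  rewrite lt_neqAle [_ <= _]ac andbT; apply: contraNneq abN => eac.
  have := cons_t _ _ abt cdt; have := cons_t _ _ cdt abt.
  by rewrite /= eac ltxx; case: ltgtP => // -> _ _; rewrite mem_head.
have lt_bd : b < d by rewrite -(cons_t _ _ abt cdt).
have fcd : f c = d by apply: (ft (c, d)); rewrite mem_head.
have m0 : 0 < (d - b) / (c - a) by rewrite divr_gt0 ?subr_gt0.
have [h [hi hge hlt]] := increasing_glue m0 fi fcd.
exists h => // p; rewrite inE => /predU1P[->|pt] /=.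
  rewrite hlt// -[a - c]opprB mulrN mulfVK ?subr_eq0 ?gt_eqF//.
  by rewrite opprB addrC subrK.
rewrite hge ?ft//.
have le1_trans : transitive le1 by move=> p1 p2 p3; exact: le_trans.
move: pt; rewrite inE => /predU1P[->//|pt].
by have /allP/(_ _ pt) := order_path_min le1_trans ct.
Qed.

(** Freeness means that the bijections by which the basis elements act may be
    chosen independently of each other. *)
Lemma free_basis_increasing_action (I : Type) (F : groupType) (x : I -> F)
    (s : I -> seq (rat * rat)) :
  free_basis x -> (forall i, increasing_graph (s i)) ->
  exists phi : F -> bijection rat,
    [/\ {morph phi : g h / (g * h)%g}, forall g, increasing (phi g) &
        forall i, {in s i, forall p, phi (x i) p.1 = p.2}].
Proof.
move=> hx /(_ _)/increasing_extension/cid2 ext.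
have [phi [phiM phix _]] := hx _ (fun i => s2val (ext i)).
have phixi i : increasing (phi (x i)) by rewrite phix; case: (ext i).
exists phi; split=> //; last first.
  by move=> i p; rewrite phix; case: (ext i) => f /= _; exact.
apply: (free_basis_ind hx) => [|i g]; first by rewrite (morph_one phiM).
rewrite phiM; split=> gi u v uv; last exact/phixi/gi.
by rewrite -(increasing_mono (phixi i)); apply: gi.
Qed.

End IncreasingBijections.

(** * Finite connected pieces of the Cayley graph *)

Section Joined.
Variables (I : Type) (F : groupType) (x : I -> F).
Implicit Types (T : seq F) (u : F).

Definition edge_invariant T (Q : F -> Prop) :=
  forall i u, u \in T -> x i * u \in T -> Q (x i * u) <-> Q u.

(** [u] lies in the connected component of [1] in the graph that the Cayley
    graph induces on [T].  Stating this as an induction principle over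
    properties invariant along edges lets an edge be followed both ways and is
    the form in which the action is computed on [T]. *)
Definition joined T u :=
  forall Q : F -> Prop, Q 1 -> edge_invariant T Q -> Q u.

Lemma joined_sub T T' u : {subset T <= T'} -> joined T u -> joined T' u.
Proof. by move=> sub jT Q Q1 QT; apply: jT => // i v /sub ? /sub; exact: QT. Qed.

Lemma joined_edge i T u : u \in T -> x i * u \in T ->
  joined T (x i * u) <-> joined T u.
Proof.
by move=> uT xuT; split=> jT Q Q1 QT; have := jT Q Q1 QT; rewrite QT.
Qed.

(** Every element is reached from [1] one letter at a time, each step adding one
    vertex next to an existing one; finitely many such pieces all contain [1],
    so their union is still connected. *)
Lemma joined_cover (S : seq F) : free_basis x ->
  exists T, [/\ 1 \in T, {subset S <= T} & {in T, forall u, joined T u}].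
Proof.
move=> hx.
pose covered g :=
  exists T, [/\ 1 \in T, g \in T & {in T, forall u, joined T u}].
have cons_joined T v : 1 \in T -> {in T, forall u, joined T u} ->
    joined (v :: T) v -> {in v :: T, forall u, joined (v :: T) u}.
  move=> T1 jT jv u; rewrite inE => /predU1P[->//|/jT].
  by apply: joined_sub => w wT; rewrite inE wT orbT.
have cov : forall g, covered g.
  apply: (free_basis_ind hx) => [|i g].
    by exists [:: 1]; split; rewrite ?mem_head// => u; rewrite inE => /eqP -> Q.
  split=> -[T [T1 gT jT]].
    exists (g :: T); rewrite !inE T1 eqxx orbT; split=> //.
    apply: cons_joined => //; apply/(joined_edge (i := i));
      rewrite ?inE ?eqxx ?gT ?orbT//.
    by apply: joined_sub (jT _ gT) => w wT; rewrite inE wT orbT.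
  exists (x i * g :: T); rewrite !inE T1 eqxx orbT; split=> //.
  apply: cons_joined => //; apply/joined_edge; rewrite ?inE ?eqxx ?gT ?orbT//.
  by apply: joined_sub (jT _ gT) => w wT; rewrite inE wT orbT.
elim: S => [|g S [T [T1 ST jT]]].
  by exists [:: 1]; split; rewrite ?mem_head// => u; rewrite inE => /eqP -> Q.
have [T' [_ gT' jT']] := cov g.
exists (T ++ T'); split; first by rewrite mem_cat T1.
  by move=> u; rewrite inE mem_cat => /predU1P[->|/ST->//]; rewrite gT' orbT.
move=> u; rewrite mem_cat => /orP[/jT|/jT'];
  by apply: joined_sub => w wT; rewrite mem_cat wT ?orbT.
Qed.

End Joined.

(** * The order of a positive cone *)

Lemma positive_coneP (F : groupType) (P : F -> bool) : positive_cone P <->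
  [/\ forall g h, P g -> P h -> P (g * h), P 1 = false &
      forall g, g != 1 -> P g^-1 = ~~ P g].
Proof.
split=> [[/= mulP covP [P1 _ PV]]|[mulP P1 PV]].
  split=> //.
    by apply/negP => p1; have : (set0 : set F) 1 by rewrite -P1.
  move=> g g1; have [Pg|nPg] := boolP (P g) => /=.
    apply/negP => PgV; suff : (set0 : set F) g by [].
    by rewrite -PV; split=> //; exists g^-1; rewrite ?invgK.
  have : [set: F]%classic g by [].
  rewrite covP => -[[/= e|/= Pg]|[p /= Pp <-]].
  - by rewrite e eqxx in g1.
  - by rewrite Pg in nPg.
  - by rewrite invgK.
have nPV g : P g -> P g^-1 = false.
  by move=> Pg; rewrite PV ?Pg//; apply: contraTneq Pg => ->; rewrite P1.
split=> //=.
  apply/seteqP; split=> // g _; have [->|g1] := eqVneq g 1; first by left; left.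
  have [Pg|nPg] := boolP (P g); first by left; right.
  by right; exists g^-1; rewrite ?invgK //= PV.
split; apply/seteqP; split=> // g /=.
- by move=> [->]; rewrite P1.
- by move=> [->] [p Pp pV]; rewrite -[p]invgK pV invg1 P1 in Pp.
- by move=> [Pg] [p Pp pg]; have := nPV _ Pp; rewrite pg Pg.
Qed.

Section ConePosition.
Variables (F : groupType) (P : F -> bool).
Hypothesis coneP : positive_cone P.
Implicit Types (T : seq F) (u v g : F).

Definition cone_lt u v := P (u^-1 * v).

Lemma cone_lt_irr u : cone_lt u u = false.
Proof. by have /positive_coneP[_ P1 _] := coneP; rewrite /cone_lt mulVg. Qed.

Lemma cone_lt_trans v u w : cone_lt u v -> cone_lt v w -> cone_lt u w.
Proof.
have /positive_coneP[PM _ _] := coneP.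
by move=> /PM uv /uv; rewrite /cone_lt -mulgA mulVKg.
Qed.

Lemma cone_lt_total u v : u != v -> cone_lt v u = ~~ cone_lt u v.
Proof.
have /positive_coneP[_ _ PV] := coneP.
move=> uv; rewrite /cone_lt -PV ?invgM ?invgK//.
by apply: contraNneq uv => e; rewrite -(mulVKg u v) e mulg1.
Qed.

Lemma cone_lt_mull g u v : cone_lt (g * u) (g * v) = cone_lt u v.
Proof. by rewrite /cone_lt invgM -mulgA mulKg. Qed.

(** The conjugates of [g] and [g^-1] by [u] are inverse to each other, so one
    of them is positive. *)
Lemma cone_lt_step u g : g != 1 -> cone_lt u (g * u) || cone_lt u (g^-1 * u).
Proof.
have /positive_coneP[_ _ PV] := coneP.
move=> g1; rewrite /cone_lt mulgA [in X in _ || X]mulgA.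
have -> : u^-1 * g^-1 * u = (u^-1 * g * u)^-1 by rewrite !invgM invgK mulgA.
rewrite PV ?orbN//; apply: contraNneq g1 => e.
by rewrite -(mulgK u g) -(mulVKg u (g * u)) [u^-1 * _]mulgA e mulg1 mulgV.
Qed.

Lemma cone_max T u0 : u0 \in T ->
  exists2 t, t \in T & {in T, forall u, u != t -> cone_lt u t}.
Proof.
elim: T u0 => // a T IH _ _; case: T IH => [_|b T].
  by exists a; rewrite ?mem_head// => u; rewrite inE => /eqP ->; rewrite eqxx.
move=> /(_ b (mem_head _ _))[t tT tmax]; have [ta|nta] := boolP (cone_lt t a).
  exists a; first exact: mem_head.
  move=> u; rewrite inE => /predU1P[->|uT _]; first by rewrite eqxx.
  by have [->//|/(tmax _ uT)ut] := eqVneq u t; exact: cone_lt_trans ut ta.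
exists t; first by rewrite inE tT orbT.
move=> u; rewrite inE => /predU1P[->|uT]; last exact: tmax.
by move=> ta; rewrite cone_lt_total// eq_sym.
Qed.

(** An order embedding of [T] in the rational line, with gaps of length at
    least 1 between the points of [T]. *)
Definition position T u : rat := (count (cone_lt^~ u) T)%:R%R.

Lemma position_step T u v : u \in T -> cone_lt u v ->
  (position T u + 1 <= position T v)%R.
Proof.
move=> uT uv; rewrite /position natr1 ler_nat -addn1.
have -> : 1%N = (0 < count_mem u T)%N by rewrite -has_count has_pred1 uT.
rewrite (@leq_trans (count (cone_lt^~ u) T + count_mem u T))//.
  by rewrite leq_add2l; case: (count _ T).
rewrite -count_predUI (@eq_count _ (predI _ _) pred0) => [|w /=].
  rewrite count_pred0 addn0; apply: sub_count => w /= /orP[wu|/eqP->//].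
  exact: cone_lt_trans wu uv.
by have [->|] := eqVneq w u; rewrite ?cone_lt_irr ?andbF.
Qed.

Lemma position_lt T :
  {in T &, forall u v, (position T u < position T v)%R = cone_lt u v}.
Proof.
have lt_position u v : u \in T -> cone_lt u v -> (position T u < position T v)%R.
  by move=> uT /(position_step uT); apply: lt_le_trans; rewrite ltrDl.
move=> u v uT vT; have [->|uv] := eqVneq u v; first by rewrite cone_lt_irr ltxx.
apply/idP/idP => [|/lt_position]; last exact.
apply: contraLR; rewrite -cone_lt_total// => /lt_position -/(_ vT).
by rewrite -leNgt => /ltW.
Qed.

End ConePosition.

(** * Perturbation of a positive cone *)

(** A basis element can be sent to the nontrivial permutation of [bool]. *)
Lemma free_basis_neq1 (I : Type) (F : groupType) (x : I -> F) i :
  free_basis x -> x i != 1.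
Proof.
move=> hx; pose neg : bijection bool := Bijection negbK negbK.
have [f [fM fx _]] := hx _ (fun=> neg).
apply/eqP => xi1; have := fx i; rewrite xi1 (morph_one fM).
by move=> /(congr1 (fun s : bijection bool => s true)).
Qed.

(** The order on [F] obtained by comparing the images of [p]; elements with
    the same image are compared by [P], which makes the order total when [p]
    has a nontrivial stabilizer. *)
Definition orbit_cone (F : groupType) (phi : F -> bijection rat) (p : rat)
    (P : F -> bool) (g : F) : bool :=
  (p < phi g p)%R || ((phi g p == p) && P g).

Lemma orbit_cone_positive (F : groupType) (phi : F -> bijection rat) p
    (P : F -> bool) :
  {morph phi : g h / g * h} -> (forall g, increasing (phi g)) ->
  positive_cone P -> positive_cone (orbit_cone phi p P).
Proof.
move=> phiM /(_ _)/increasing_mono phi_lt /positive_coneP[PM P1 PV].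
have phi1 : phi 1 = 1 := morph_one phiM.
apply/positive_coneP; split=> [g h||g g1]; rewrite /orbit_cone.
- rewrite phiM bijM => /orP[pg|/andP[/eqP pg Pg]] /orP[ph|/andP[/eqP ph Ph]].
  + by rewrite (lt_trans pg)// phi_lt.
  + by rewrite ph pg.
  + by rewrite -[X in (X < _)%R]pg phi_lt ph.
  + by rewrite ph pg eqxx PM ?orbT.
- by rewrite phi1 bij1 ltxx P1 andbF.
- rewrite (morph_inv phiM) -[in LHS](phi_lt g) bijVK PV//.
  rewrite -(inj_eq (@bij_injective _ (phi g))) bijVK.
  by case: ltgtP.
Qed.

(** With [t] the greatest of the finitely many relevant points and [t'] a
    larger neighbor of it, the edge between [t] and [t'] is labelled
    by [i], so dropping the edges labelled by [j] at [t'] leaves [t'] joined to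
    [1] while the image of its point under [x j] becomes free.  This is where two basis elements are
    needed. *)
Lemma cone_perturbation (I : eqType) (F : groupType) (x : I -> F) (i j : I)
    (P : F -> bool) (S : seq F) :
  free_basis x -> i != j -> positive_cone P ->
  exists P' : F -> bool,
    [/\ positive_cone P', {in S, P' =1 P} & P' <> P].
Proof.
move=> hx ij coneP; have /positive_coneP[_ P1 _] := coneP.
have [T [T1 ST jT]] := joined_cover S hx.
have [t tT tmax] := cone_max coneP T1.
have [t' [tt' t'E]] : exists t', cone_lt P t t' /\ (t' = x i * t \/ t = x i * t').
  have /orP[?|?] := cone_lt_step coneP t (free_basis_neq1 i hx).
    by exists (x i * t); split=> //; left.
  by exists ((x i)^-1 * t); split=> //; right; rewrite mulVKg.
have T_lt u : u \in T -> cone_lt P u t'.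
  move=> uT; have [-> //|ut] := eqVneq u t.
  exact: cone_lt_trans (tmax _ uT ut) tt'.
pose T' := t' :: T.
have t'T' : t' \in T' by exact: mem_head.
have TT' u : u \in T -> u \in T' by move=> uT; rewrite inE uT orbT.
pose pos := position P T'.
have pos_lt : {in T' &, forall u v, (pos u < pos v)%R = cone_lt P u v}.
  exact: position_lt.
(* Points of [T] lie at distance at least 1 below [pos t'], so a shift of
   [pos t'] by more than -1 keeps the partial map of [x j] increasing; the sign
   of the shift is the opposite of the sign of [t'^-1 * x j * t'] for [P]. *)
pose delta : rat := if P (t'^-1 * x j * t') then (- 2%:R^-1)%R else 1%R.
have delta_gt : (-1 < delta)%R by rewrite /delta; case: ifP.
pose D k := if k == j then T else T'.
have DT' k u : u \in D k -> u \in T' by rewrite /D; case: ifP => // _ /TT'.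
have TD k u : u \in T -> u \in D k by rewrite /D; case: ifP => // _ /TT'.
pose s k := [seq (pos u, pos (x k * u)) | u <- D k & x k * u \in D k] ++
            (if k == j then [:: (pos t', pos t' + delta)%R] else [::]).
have s_incr k : increasing_graph (s k).
  have in_old p :
      p \in [seq (pos u, pos (x k * u)) | u <- D k & x k * u \in D k] ->
      exists u, [/\ u \in D k, x k * u \in D k & p = (pos u, pos (x k * u))].
    by move=> /mapP[u]; rewrite mem_filter => /andP[]; exists u.
  have in_new p :
      p \in (if k == j then [:: (pos t', pos t' + delta)%R] else [::]) ->
      k = j /\ p = (pos t', pos t' + delta)%R.
    by have [->|] := eqVneq k j; rewrite inE // => /eqP ->.
  have far u : u \in T -> (pos u + 1 <= pos t')%R.
    by move=> uT; apply: position_step; rewrite ?TT' ?T_lt.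
  move=> p q; rewrite !mem_cat => /orP[/in_old|/in_new] + /orP[/in_old|/in_new].
  - move=> [u [uD xuD ->]] [v [vD xvD ->]] /=.
    by rewrite !pos_lt ?(DT' k)// cone_lt_mull.
  - move=> [u [+ + ->]] [kj ->] /=; rewrite /D kj eqxx => /far + /far.
    by move=> ? ?; apply/idP/idP => _; lra.
  - move=> [kj ->] [u [+ + ->]] /=; rewrite /D kj eqxx => /far + /far.
    by move=> ? ?; apply/idP/idP => ?; lra.
  - by move=> [_ ->] [_ ->] /=; rewrite !ltxx.
have [phi [phiM phi_incr phi_s]] := free_basis_increasing_action hx s_incr.
have phi_lt g := increasing_mono (phi_incr g).
pose p := pos 1.
have edge k u : u \in D k -> x k * u \in D k ->
    phi (x k * u) p = pos (x k * u) <-> phi u p = pos u.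
  move=> uD xuD.
  have xk : phi (x k) (pos u) = pos (x k * u).
    apply: (phi_s k (pos u, pos (x k * u))); rewrite mem_cat; apply/orP; left.
    by apply/mapP; exists u; rewrite // mem_filter xuD.
  by rewrite phiM bijM -xk; split=> [|->//]; exact: bij_injective.
have phi_T u : u \in T -> phi u p = pos u.
  move=> /jT/(_ (fun v => phi v p = pos v)); apply=> [|k v vT xvT].
    by rewrite (morph_one phiM).
  by apply: edge; exact: TD.
have Di : D i = T' by rewrite /D (negbTE ij).
have phi_t' : phi t' p = pos t'.
  have tT' := TT' _ tT; have tE := phi_T _ tT.
  case: t'E => t'E; first by have e := edge i t; rewrite Di -t'E in e; apply/e.
  by have e := edge i t'; rewrite Di -t'E in e; apply/e.
have phi_xj : phi (x j) (pos t') = (pos t' + delta)%R.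
  apply: (phi_s j (pos t', pos t' + delta)%R).
  by rewrite mem_cat eqxx mem_head orbT.
exists (orbit_cone phi p P); split.
- exact: orbit_cone_positive.
- move=> u /ST uT; rewrite /orbit_cone phi_T// pos_lt ?TT'//.
  rewrite {1}/cone_lt invg1 mul1g; case: (boolP (P u)) => //= Pu.
  by rewrite andbF.
(* Applying the increasing map [phi t'], the new sign of [t'^-1 * x j * t'] is
   read off by comparing [phi (x j) (pos t')] with [pos t']. *)
- move=> /(congr1 (fun Q : F -> bool => Q (t'^-1 * x j * t'))).
  rewrite /orbit_cone -(phi_lt t') -(inj_eq (@bij_injective _ (phi t'))).
  rewrite !phiM (morph_inv phiM) !bijM bijVK phi_t' phi_xj.
  rewrite ltrDl addrC -subr_eq0 addrK /delta.
  by case: (P _).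
Qed.

(** * Neighborhoods of a positive cone *)

(** The sets containing every function that agrees with [P] on some finite set
    form a filter, and this filter converges to [P] at each point. *)
Lemma nbhs_ptws_bool (F : eqType) (P : {ptws F -> bool})
    (A : set {ptws F -> bool}) :
  nbhs P A ->
  exists S : seq F, forall Q : F -> bool, {in S, Q =1 P} -> A Q.
Proof.
pose B : set_system {ptws F -> bool} := fun A =>
  exists S : seq F, forall Q : F -> bool, {in S, Q =1 P} -> A Q.
have FB : Filter B.
  split=> [|A1 A2 [S1 H1] [S2 H2]|A1 A2 A12 [S H]]; first by exists [::].
    exists (S1 ++ S2) => Q QP; split; [apply: H1|apply: H2] => u uS;
      by apply: QP; rewrite mem_cat uS ?orbT.
  by exists S => Q /H /A12.
suff : (B --> P)%classic by apply.
apply/cvg_sup => g A' -[W [[V _ VW] WP] WA].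
exists [:: g] => Q QP; apply: WA; move: WP.
by rewrite -VW /= QP ?mem_head.
Qed.

Theorem corollary2p5 (n : nat) (F : groupType) (hn : (2 <= n)%N)
    (hF : free_of_rank n F) :
  isolated [set: left_ordering_space F]%classic = set0%classic.
Proof.
case: hF => x hx; apply/seteqP; split=> // P [_ [V nV VP]].
have coneP : positive_cone (val P) := set_mem (valP P).
have [A nA AV] : exists2 A : set {ptws F -> bool}, nbhs (val P) A &
    (val @^-1` A `<=` V)%classic.
  have [W [[A oA <-] WP] WV] := nV.
  by exists A => //; exact: open_nbhs_nbhs.
have [S SA] := nbhs_ptws_bool nA.
have ij : Ordinal (ltnW hn) != Ordinal hn by [].
have [P' [coneP' SP' neq]] := cone_perturbation S hx ij coneP.
pose Q : left_ordering_space F :=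
  exist _ (P' : {ptws F -> bool}) (mem_set coneP').
have : (V `&` [set: left_ordering_space F])%classic Q by split=> //; exact/AV/SA.
by rewrite VP => /(congr1 val)/neq.
Qed.
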